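(* Let $r$ be an integer and let $g_r(x)$ be the formal power series with $g_r(x)=1+x\,g_r(x)^r$. Then, as an identity of Riordan arrays, $$(g_r(x),\,x\,g_r(x))=(g_r(x),\,x\,g_r(x)^r)\cdot\left(1,\,\frac{x}{(1+x)^{r-1}}\right).$$
   Context: $g_r(x)\in\mathbb{Q}[[x]]$ is the unique formal power series with constant term $1$ satisfying $g_r(x)=1+x\,g_r(x)^r$. A Riordan array is a pair $(g(x),f(x))$ of formal power series with $g(0)\neq 0$, $f(0)=0$, $f'(0)\neq 0$, identified with the infinite lower-triangular matrix with entries $t_{n,k}=[x^n]\,g(x)f(x)^k$, $n,k\ge0$. The product of Riordan arrays is $(g,f)\cdot(u,v)=\left(g(x)\,u(f(x)),\,v(f(x))\right)$, which corresponds to matrix multiplication. The array $(g_r(x),x\,g_r(x))$ is called the Fuss-Catalan-Riordan array. *)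

(* Defs.v *)
From HB Require Import structures.
From mathcomp Require Import all_boot all_order all_algebra.
From mathcomp Require Import boolp.

Set Implicit Arguments.
Unset Strict Implicit.
Unset Printing Implicit Defensive.

Import GRing.Theory.
Local Open Scope ring_scope.

(* A dedicated record rather than an alias of nat -> K, so that the Cauchy
   product does not compete with the pointwise ring structure on functions. *)
Record fps (K : fieldType) := Fps { coefs :> nat -> K }.

Notation "{ 'fps' K }" := (fps K) (at level 0, format "{ 'fps'  K }").

Section FpsRing.
Variable K : fieldType.
Implicit Types (f g h u : {fps K}) (n i : nat).

Lemma fpsP f g : (forall n, f n = g n) <-> f = g.
Proof.
by case: f g => [f] [g]; split=> [/= e|[->]//]; congr Fps; apply/funext.
Qed.

(* Equality of power series is not decidable: these instances are classical. *)
HB.instance Definition _ := gen_eqMixin (fps K).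
HB.instance Definition _ := gen_choiceMixin (fps K).

Definition fpsC (c : K) : {fps K} := Fps (fun n => if n == 0%N then c else 0).
Definition fps_add f g : {fps K} := Fps (fun n => f n + g n).
Definition fps_opp f : {fps K} := Fps (fun n => - f n).
Definition fps_mul f g : {fps K} :=
  Fps (fun n => \sum_(i < n.+1) f i * g (n - i)%N).

Fact fps_addA : associative fps_add.
Proof. by move=> f g h; apply/fpsP => n /=; rewrite addrA. Qed.
Fact fps_addC : commutative fps_add.
Proof. by move=> f g; apply/fpsP => n /=; rewrite addrC. Qed.
Fact fps_add0 : left_id (fpsC 0) fps_add.
Proof. by move=> f; apply/fpsP => n /=; rewrite if_same add0r. Qed.
Fact fps_addN : left_inverse (fpsC 0) fps_opp fps_add.
Proof. by move=> f; apply/fpsP => n /=; rewrite if_same addNr. Qed.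

HB.instance Definition _ :=
  GRing.isZmodule.Build (fps K) fps_addA fps_addC fps_add0 fps_addN.

Definition fps_trunc N f : {poly K} := \poly_(i < N) f i.

Lemma fps_mul_trunc N f g n : (n < N)%N ->
  fps_mul f g n = (fps_trunc N f * fps_trunc N g)`_n.
Proof.
move=> ltnN; rewrite coefM /=; apply: eq_bigr => i _; rewrite !coef_poly.
by rewrite (leq_ltn_trans (leq_ord i) ltnN) (leq_ltn_trans (leq_subr _ _) ltnN).
Qed.

Fact fps_mulC : commutative fps_mul.
Proof.
by move=> f g; apply/fpsP => n; rewrite !(fps_mul_trunc _ _ (ltnSn n)) mulrC.
Qed.

Fact fps_mulA : associative fps_mul.
Proof.
move=> f g h; apply/fpsP => n.
pose T := fps_trunc n.+1.
transitivity (T f * (T g * T h))`_n.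
  rewrite coefM /=; apply: eq_bigr => i _.
  have lt_in : (i < n.+1)%N by [].
  have lt_nin : (n - i < n.+1)%N by rewrite ltnS leq_subr.
  by rewrite coef_poly lt_in -(fps_mul_trunc _ _ lt_nin).
rewrite mulrA coefM /=; apply: eq_bigr => i _.
have lt_in : (i < n.+1)%N by [].
have lt_nin : (n - i < n.+1)%N by rewrite ltnS leq_subr.
by rewrite -(fps_mul_trunc _ _ lt_in) /= coef_poly lt_nin.
Qed.

Fact fps_mul1 : left_id (fpsC 1) fps_mul.
Proof.
move=> f; apply/fpsP => n /=; rewrite big_ord_recl /= mul1r subn0.
by rewrite big1 ?addr0 // => i _; rewrite mul0r.
Qed.

Fact fps_mulDl : left_distributive fps_mul +%R.
Proof.
move=> f g h; apply/fpsP => n /=; rewrite -big_split /=.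
by apply: eq_bigr => i _; rewrite mulrDl.
Qed.

Fact fps_oner_neq0 : fpsC 1 != 0.
Proof.
by apply/eqP => /(congr1 (fun f : fps K => f 0%N)) /eqP; rewrite /= oner_eq0.
Qed.

HB.instance Definition _ := GRing.Zmodule_isComNzRing.Build (fps K)
  fps_mulA fps_mulC fps_mul1 fps_mulDl fps_oner_neq0.

Lemma coefs0 n : (0 : {fps K}) n = 0.
Proof. exact: if_same. Qed.
Lemma coefs1 n : (1 : {fps K}) n = (n == 0%N)%:R.
Proof. by rewrite /=; case: eqP. Qed.
Lemma coefsD f g n : (f + g) n = f n + g n.
Proof. by []. Qed.
Lemma coefsN f n : (- f) n = - f n.
Proof. by []. Qed.
Lemma coefsB f g n : (f - g) n = f n - g n.
Proof. by []. Qed.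
Lemma coefsM f g n : (f * g) n = \sum_(i < n.+1) f i * g (n - i)%N.
Proof. by []. Qed.
Lemma coefsM0 f g : (f * g) 0%N = f 0%N * g 0%N.
Proof. by rewrite coefsM big_ord1. Qed.

Lemma coefs_sum (I : Type) (s : seq I) (P : pred I) (F : I -> {fps K}) n :
  (\sum_(i <- s | P i) F i) n = \sum_(i <- s | P i) F i n.
Proof. by elim/big_rec2: _ => [|i y z _ <-]; rewrite ?coefs0. Qed.

Lemma coefs_sumM (I : Type) (s : seq I) (P : pred I) (F : I -> {fps K}) f n :
  (f * \sum_(i <- s | P i) F i) n = \sum_(i <- s | P i) (f * F i) n.
Proof. by rewrite mulr_sumr coefs_sum. Qed.

Lemma coefsX_small h k n : h 0%N = 0 -> (n < k)%N -> (h ^+ k) n = 0.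
Proof.
move=> h0; elim: k n => // k IHk n ltnk; rewrite exprS coefsM big1 // => i _.
case: (posnP i) => [->|i_gt0]; first by rewrite h0 mul0r.
rewrite IHk ?mulr0 //; have := ltn_ord i; rewrite ltnS => lein.
by rewrite -ltnS (leq_trans _ ltnk) // ltnS ltn_subrL i_gt0 (leq_trans i_gt0).
Qed.

Definition fps_unit : {pred {fps K}} := fun f => f 0%N != 0.

(* Geometric series: f = c (1 - h) with c = f 0 and h 0 = 0, so that
   f^-1 = c^-1 (1 + h + h^2 + ...), where h ^+ k has no coefficient below k. *)
Definition fps_inv f : {fps K} :=
  if f 0%N != 0 then
    let h := 1 - fpsC (f 0%N)^-1 * f in
    fpsC (f 0%N)^-1 * Fps (fun n => \sum_(k < n.+1) (h ^+ k) n)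
  else f.

Lemma fps_mulVf : {in fps_unit, left_inverse 1 fps_inv *%R}.
Proof.
move=> f; rewrite -topredE /= => f0; rewrite /fps_inv [_ != 0]f0.
set c := fpsC _; set h := 1 - c * f; set S := Fps _.
have h0 : h 0%N = 0 by rewrite /h coefsB coefsM0 coefs1 /= mulVf ?subrr.
have -> : c * S * f = (1 - h) * S by rewrite /h opprB addrC subrK mulrAC.
apply/fpsP => n; pose Sn := \sum_(k < n.+1) h ^+ k.
have SE i : (i < n.+1)%N -> S i = Sn i.
  move=> lt_in; rewrite /Sn coefs_sum /= -!(big_mkord xpredT (fun k => (h ^+ k) i)).
  rewrite [RHS](big_cat_nat _ lt_in) //= [X in _ + X]big_nat_cond.
  rewrite [X in _ + X]big1 ?addr0 // => k /andP[/andP[ltik _] _].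
  exact: coefsX_small.
transitivity (((1 - h) * Sn) n).
  by rewrite !coefsM; apply: eq_bigr => i _; rewrite SE // ltnS leq_subr.
have -> : (1 - h) * Sn = 1 - h ^+ n.+1.
  rewrite -[1 in RHS](expr1n _ n.+1) subrXX /Sn; congr (_ * _).
  by apply: eq_bigr => i _; rewrite expr1n mul1r.
by rewrite coefsB (coefsX_small h0) ?subr0.
Qed.

Fact fps_unitPl f g : g * f = 1 -> fps_unit f.
Proof.
move=> /(congr1 (fun f : fps K => f 0%N)); rewrite coefsM0 coefs1 => e.
by apply/eqP => f0; move/eqP: e; rewrite f0 mulr0 eq_sym oner_eq0.
Qed.

Fact fps_inv_out : {in [predC fps_unit], fps_inv =1 id}.
Proof.
by move=> f; rewrite inE /= -topredE /= /fps_inv => /negbTE; rewrite /fps_unit => ->.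
Qed.

HB.instance Definition _ := GRing.ComNzRing_hasMulInverse.Build (fps K)
  fps_mulVf fps_unitPl fps_inv_out.

Lemma fps_unitE f : (f \is a GRing.unit) = (f 0%N != 0).
Proof. by []. Qed.

Definition fpsX : {fps K} := Fps (fun n => (n == 1%N)%:R).

Lemma coefsXM f n : (fpsX * f) n = if n is m.+1 then f m else 0.
Proof.
rewrite coefsM big_ord_recl /= mul0r add0r.
case: n => [|n]; first by rewrite big_ord0.
rewrite big_ord_recl /= mul1r subSS subn0 big1 ?addr0 // => i _.
by rewrite mul0r.
Qed.

(* u(f(x)), meaningful when f 0 = 0: then f ^+ k only has terms of degree at
   least k, so the sum over all k reduces to k <= n in degree n. *)
Definition fps_comp u f : {fps K} :=
  Fps (fun n => \sum_(k < n.+1) u k * (f ^+ k) n).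

(* The coefficient A.2 1 is the value at 0 of the derivative of A.2. *)
Definition is_riordan (A : {fps K} * {fps K}) : bool :=
  [&& A.1 0%N != 0, A.2 0%N == 0 & A.2 1%N != 0].

Definition riordan_mul (A B : {fps K} * {fps K}) : {fps K} * {fps K} :=
  (A.1 * fps_comp B.1 A.2, fps_comp B.2 A.2).

End FpsRing.

Arguments fpsX {K}.

Section FussCatalan.
Variable K : fieldType.
Implicit Types (f g h : {fps K}) (n : nat) (r : int).

Definition fps_eqmod n f g := forall i, (i < n)%N -> f i = g i.

Lemma fps_eqmodM n f f' g g' :
  fps_eqmod n f f' -> fps_eqmod n g g' -> fps_eqmod n (f * g) (f' * g').
Proof.
move=> ef eg i ltin; rewrite !coefsM; apply: eq_bigr => j _.
rewrite ef ?eg //; first exact: leq_ltn_trans (leq_subr _ _) ltin.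
exact: leq_ltn_trans (leq_ord j) ltin.
Qed.

Lemma fps_eqmodX n f g k : fps_eqmod n f g -> fps_eqmod n (f ^+ k) (g ^+ k).
Proof.
by move=> e; elim: k => // k IHk; rewrite !exprS; apply: fps_eqmodM.
Qed.

Lemma fps_eqmodV n f g : f 0%N != 0 -> g 0%N != 0 ->
  fps_eqmod n f g -> fps_eqmod n f^-1 g^-1.
Proof.
move=> f0 g0 e i lti.
have e1 : f^-1 * (g * g^-1) = f^-1 by rewrite divrr ?mulr1.
have e2 : f^-1 * (f * g^-1) = g^-1 by rewrite mulKr.
rewrite -[in LHS]e1 -[in RHS]e2; apply: fps_eqmodM lti => // j ltj.
by apply: fps_eqmodM ltj => // k ltk; rewrite e.
Qed.

Lemma coefs0X f k : f 0%N = 1 -> (f ^+ k) 0%N = 1.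
Proof.
by move=> f0; elim: k => [|k IHk]; rewrite ?exprS ?coefsM0 ?f0 ?IHk ?mulr1.
Qed.

Lemma fps_eqmodXz n f g r : f 0%N = 1 -> g 0%N = 1 ->
  fps_eqmod n f g -> fps_eqmod n (f ^ r) (g ^ r).
Proof.
move=> f0 g0 e; case: r => k; first exact: fps_eqmodX.
by apply: fps_eqmodV; rewrite ?coefs0X ?oner_neq0 //; apply: fps_eqmodX.
Qed.

Let F r h : {fps K} := 1 + fpsX * h ^ r.

Let F0 r h : F r h 0%N = 1.
Proof. by rewrite /F coefsD coefsXM addr0 coefs1. Qed.

Let F_eqmod r n f g : f 0%N = 1 -> g 0%N = 1 ->
  fps_eqmod n f g -> fps_eqmod n.+1 (F r f) (F r g).
Proof.
move=> f0 g0 e [|i] lti; first by rewrite !F0.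
by rewrite /F !coefsD !coefsXM (fps_eqmodXz r f0 g0 e).
Qed.

Lemma fuss_catalan_exists_unique r :
  exists! g : {fps K}, g 0%N = 1 /\ g = 1 + fpsX * g ^ r.
Proof.
pose H n := iter n (F r) 1.
have H0 n : H n 0%N = 1 by case: n => [|n] //; rewrite /H iterS F0.
have HS n : fps_eqmod n.+1 (H n) (H n.+1).
  elim: n => [|n IHn]; last exact: F_eqmod.
  by case=> // _; rewrite !H0.
pose g : {fps K} := Fps (fun n => H n n).
have gH n : fps_eqmod n.+1 g (H n).
  elim: n => [|n IHn] i; first by case: i.
  rewrite ltnS leq_eqVlt => /predU1P[->//|lti].
  by rewrite IHn // HS.
have g0 : g 0%N = 1 by rewrite (gH 0%N).
have gE : g = F r g.
  apply/fpsP => m; rewrite (gH m.+1) ?ltnS ?leqnSn //.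
  by symmetry; apply: (@F_eqmod r m.+1) => //; apply: leqnSn.
exists g; split=> // f [f0 fE]; apply/fpsP => n.
suff: fps_eqmod n.+1 g f by apply.
elim: n => [|n IHn]; first by case=> // _; rewrite g0 f0.
by rewrite gE fE; apply: F_eqmod.
Qed.

End FussCatalan.

(* Main.v *)
(** Composition with a series [f] without constant term is multiplicative, so
    with [f = x g^r] and hence [1 + f = g], the series [w = x / (1 + x)^(r-1)]
    satisfies [w(f) g^(r-1) = f = (x g) g^(r-1)], whence [w(f) = x g]. *)
Require Import Defs.
From HB Require Import structures.
From mathcomp Require Import all_boot all_order all_algebra.

Import GRing.Theory.
Local Open Scope ring_scope.

Lemma coefsCM (K : fieldType) (c : K) (f : {fps K}) n :
  (fpsC c * f) n = c * f n.
Proof.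
by rewrite coefsM big_ord_recl /= subn0 big1 ?addr0 // => i _; rewrite mul0r.
Qed.

(** This and the next fact make [fpsC] a ring morphism, so that [map_poly] by it respects products
    of polynomials. *)
Fact fpsC_zmod_morphism (K : fieldType) : zmod_morphism (@fpsC K).
Proof.
by move=> a b; apply/fpsP => -[|n]; rewrite coefsB //= subr0.
Qed.

Fact fpsC_monoid_morphism (K : fieldType) : monoid_morphism (@fpsC K).
Proof.
split=> // a b; apply/fpsP => n; rewrite coefsCM /=.
by case: ifP; rewrite ?mulr0.
Qed.

HB.instance Definition _ (K : fieldType) :=
  GRing.isZmodMorphism.Build K (fps K) (@fpsC K) (@fpsC_zmod_morphism K).
HB.instance Definition _ (K : fieldType) :=
  GRing.isMonoidMorphism.Build K (fps K) (@fpsC K) (@fpsC_monoid_morphism K).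

(** Since [f ^+ k] has no term below degree [k], only the coefficients of [u] up to [n] matter in
    degree [n]. Leaving [p] arbitrary above [n] allows a product of truncations, not only a
    truncation. *)
Lemma coefs_comp_horner (K : fieldType) (u f : {fps K}) (p : {poly K}) n :
  f 0%N = 0 -> (forall i, (i < n.+1)%N -> p`_i = u i) ->
  fps_comp u f n = (map_poly (@fpsC K) p).[f] n.
Proof.
(* [N] bounds both ranges: the Horner sum is padded with zeros up to [N], then cut at [n.+1]. *)
move=> f0 pu; set N := maxn n.+1 (size p).
have leN : (size (map_poly (@fpsC K) p) <= N)%N.
  by rewrite (leq_trans (size_poly _ _)) // leq_maxr.
rewrite (horner_coef_wide _ leN) coefs_sum [LHS]/=.
rewrite -!(big_mkord xpredT (fun k => u k * (f ^+ k) n)).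
rewrite -(big_mkord xpredT (fun k => ((map_poly (@fpsC K) p)`_k * f ^+ k) n)).
rewrite [RHS](big_cat_nat (n := n.+1)) ?leq_maxl //.
rewrite [X in _ = _ + X]big_nat_cond [X in _ = _ + X]big1 ?addr0.
  apply: eq_big_nat => i lti.
  by rewrite coef_map coefsCM pu.
move=> i /andP[/andP[lti _] _].
by rewrite coef_map coefsCM (@coefsX_small _ _ i n f0 lti) mulr0.
Qed.

(** In each fixed degree both sides become evaluations of polynomials at [f], and evaluation is
    multiplicative because power series commute. *)
Lemma fps_compM (K : fieldType) (u v f : {fps K}) : f 0%N = 0 ->
  fps_comp (u * v) f = fps_comp u f * fps_comp v f.
Proof.
move=> f0; apply/fpsP => n; pose T (w : {fps K}) := fps_trunc n.+1 w.
have TE (w : {fps K}) i : (i < n.+1)%N -> (T w)`_i = w i.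
  by move=> lti; rewrite coef_poly lti.
rewrite (@coefs_comp_horner _ _ _ (T u * T v) n f0); last first.
  move=> i lti; rewrite coefM; apply: eq_bigr => j _.
  by rewrite !TE // ?(leq_ltn_trans (leq_subr _ _)) // (leq_ltn_trans (leq_ord j)).
(* The factors are read in degrees [i] and [n - i], both at most [n], so the same truncations serve
   for them. *)
rewrite rmorphM hornerM !coefsM; apply: eq_bigr => i _.
congr (_ * _); symmetry; apply: coefs_comp_horner => // j ltj; apply: TE.
  exact: leq_trans ltj (ltn_ord i).
by rewrite (leq_trans ltj) // ltnS leq_subr.
Qed.

Lemma fps_comp1 (K : fieldType) (f : {fps K}) : fps_comp 1 f = 1.
Proof.
apply/fpsP => n /=; rewrite big_ord_recl /= mul1r big1 ?addr0 // => i _.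
by rewrite mul0r.
Qed.

Lemma fps_compD (K : fieldType) (u v f : {fps K}) :
  fps_comp (u + v) f = fps_comp u f + fps_comp v f.
Proof.
apply/fpsP => n; rewrite coefsD /= -big_split /=.
by apply: eq_bigr => i _; rewrite mulrDl.
Qed.

Lemma fps_compX (K : fieldType) (f : {fps K}) : f 0%N = 0 ->
  fps_comp fpsX f = f.
Proof.
move=> f0; apply/fpsP => -[|n]; first by rewrite /= big_ord1 mul0r f0.
rewrite /fps_comp [LHS]/= !big_ord_recl big1 => [|i _]; last by rewrite mul0r.
by rewrite mul0r mul1r add0r addr0.
Qed.

Lemma fps_compXz (K : fieldType) (u f : {fps K}) (z : int) :
  f 0%N = 0 -> u \is a GRing.unit -> fps_comp (u ^ z) f = fps_comp u f ^ z.
Proof.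
move=> f0 uU.
have compXn k : fps_comp (u ^+ k) f = fps_comp u f ^+ k.
  by elim: k => [|k IHk]; rewrite ?fps_comp1 // !exprS fps_compM // IHk.
case: z => k; first exact: compXn.
rewrite !NegzE -!exprnN -compXn.
(* For a negative exponent, multiplicativity sends an inverse to an inverse; this equation also
   shows that the composite is a unit. *)
have e : fps_comp (u ^- k.+1) f * fps_comp (u ^+ k.+1) f = 1.
  by rewrite -fps_compM // mulVr ?fps_comp1 // unitrX.
have wU : fps_comp (u ^+ k.+1) f \is a GRing.unit.
  by apply/unitrPr; exists (fps_comp (u ^- k.+1) f); rewrite mulrC.
by apply: (mulIr wU); rewrite e mulVr.
Qed.

(** Modulo [x] the series is 1, and integer powers, negative ones included, respect this
    congruence. *)
Lemma coefs0Xz (K : fieldType) (f : {fps K}) (z : int) :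
  f 0%N = 1 -> (f ^ z) 0%N = 1.
Proof.
move=> f0.
have e : fps_eqmod 1 f 1 by case.
by rewrite (fps_eqmodXz z f0 _ e) // exp1rz.
Qed.

Theorem proposition16 (r : int) (g : {fps rat}) (g0 : g 0%N = 1)
    (gE : g = 1 + fpsX * g ^ r) :
  [/\ is_riordan (g, fpsX * g),
      is_riordan (g, fpsX * g ^ r),
      is_riordan (1 : {fps rat}, fpsX / (1 + fpsX) ^ (r - 1))
    & (g, fpsX * g) =
      riordan_mul (g, fpsX * g ^ r) (1, fpsX / (1 + fpsX) ^ (r - 1))].
Proof.
have X0 : (1 + fpsX : {fps rat}) 0%N = 1 by rewrite coefsD coefs1 addr0.
have XU : (1 + fpsX : {fps rat}) \is a GRing.unit by rewrite fps_unitE X0 oner_neq0.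
have gU : g \is a GRing.unit by rewrite fps_unitE g0 oner_neq0.
split.
- by rewrite /is_riordan !coefsXM g0 eqxx oner_neq0.
- by rewrite /is_riordan !coefsXM g0 coefs0Xz // eqxx oner_neq0.
- by rewrite /is_riordan !coefsXM coefs1 invr_expz coefs0Xz // !eqxx mulr1n oner_neq0.
have gr : g ^ r = g * g ^ (r - 1).
  by rewrite -{2}[g]expr1z -exprzDr // addrC subrK.
set w := fpsX / _; set f := fpsX * g ^ r.
have f0 : f 0%N = 0 by rewrite coefsXM.
rewrite /riordan_mul /= fps_comp1 mulr1; congr pair.
have gzU : g ^ (r - 1) \is a GRing.unit by rewrite fps_unitE coefs0Xz // oner_neq0.
have fg : fps_comp (1 + fpsX) f = g.
  by rewrite fps_compD fps_comp1 fps_compX // -gE.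
have wX : w * (1 + fpsX) ^ (r - 1) = fpsX.
  by rewrite divrK // fps_unitE coefs0Xz // oner_neq0.
(* The third [g] is the base of the power on the right; rewriting it as a composite with [f] merges
   that side into one composite, which [wX] reduces to [f]. *)
apply: (mulIr gzU); rewrite -{3}fg -fps_compXz // -fps_compM // wX fps_compX //.
by rewrite -mulrA /f gr.
Qed.
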